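(* Let $X$ be a nonempty set and $Y$ a vector space, $f:X\to(-\infty,+\infty]$, $g:Y\to(-\infty,+\infty]$, and let $L:X\to Y$ be a mapping with $\operatorname{dom} g\cap L(\operatorname{dom} f)\neq\emptyset$. Let $\Phi$ and $\Psi$ be sets of functions $X\to\mathbb{R}$ and $Y\to\mathbb{R}$, respectively, each closed under addition of real constants and with $0\in\Phi$, $0\in\Psi$. Let $\mathcal{L}(x,\psi)=f(x)+\psi(Lx)-g^*_\Psi(\psi)$ for $x\in X$, $\psi\in\Psi$. Assume that $\Psi$ is convex, that $$\inf_{x\in X}\{f(x)+g^{**}_\Psi(Lx)\}=\inf_{x\in X}\{f(x)+g(Lx)\},$$ and that $\inf_{x\in X}\{f(x)+g(Lx)\}<+\infty$. Then the following are equivalent. (i) For every real $\alpha<\inf_{x\in X}\sup_{\psi\in\Psi}\mathcal{L}(x,\psi)$ there exist $\psi_1,\psi_2\in\Psi$ and $\bar\phi_1\in\operatorname{supp}_\Phi\mathcal{L}(\cdot,\psi_1)$, $\bar\phi_2\in\operatorname{supp}_\Phi\mathcal{L}(\cdot,\psi_2)$ such that $\bar\phi_1,\bar\phi_2$ have the intersection property at level $\alpha$. (ii) $\displaystyle\inf_{x\in X}\{f(x)+g(Lx)\}=\inf_{x\in X}\sup_{\psi\in\Psi}\mathcal{L}(x,\psi)=\sup_{\psi\in\Psi}\inf_{x\in X}\mathcal{L}(x,\psi)<+\infty.$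
   Context: $\operatorname{dom}h=\{x:h(x)<+\infty\}$. $g^*_\Psi(\psi)=\sup_{y\in Y}\{\psi(y)-g(y)\}$ for $\psi\in\Psi$, and $g^{**}_\Psi(y)=\sup_{\psi\in\Psi}\{\psi(y)-g^*_\Psi(\psi)\}$ for $y\in Y$. The support set of an extended-real function $h$ on $X$ is $\operatorname{supp}_\Phi h=\{\phi\in\Phi:\phi(x)\le h(x)\ \forall x\in X\}$. Functions $\phi_1,\phi_2:X\to\mathbb{R}$ have the intersection property at level $\alpha\in\mathbb{R}$ if for all $t\in[0,1]$: $[t\phi_1+(1-t)\phi_2<\alpha]\cap[\phi_1<\alpha]=\emptyset$ or $[t\phi_1+(1-t)\phi_2<\alpha]\cap[\phi_2<\alpha]=\emptyset$, where $[\phi<\alpha]=\{x\in X:\phi(x)<\alpha\}$. Expressions $(+\infty)+(-\infty)$ are read as $+\infty$. *)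

(* Defs.v *)
From HB Require Import structures.
From mathcomp Require Export all_boot all_order all_algebra.
From mathcomp Require Export all_classical all_reals all_analysis.

Set Implicit Arguments.
Unset Strict Implicit.
Unset Printing Implicit Defensive.

Import Order.TTheory GRing.Theory Num.Theory.

Local Open Scope classical_set_scope.
Local Open Scope ring_scope.

(* Sums of extended reals are taken in the dual scope %dE, where
   +oo + -oo = +oo; in %E the library convention is +oo + -oo = -oo. *)

Section AbstractConvexity.
Variable R : realType.

Definition edom (T : Type) (h : T -> \bar R) : set T :=
  [set x | (h x < +oo)%E].

Definition conjugate (Y : Type) (g : Y -> \bar R)
    (psi : Y -> R) : \bar R :=
  ereal_sup [set (((psi y)%:E - g y)%dE : \bar R) | y in [set: Y]].

Definition biconjugate (Y : Type) (Psi : set (Y -> R)) (g : Y -> \bar R)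
    (y : Y) : \bar R :=
  ereal_sup [set (((psi y)%:E - conjugate g psi)%dE : \bar R) | psi in Psi].

Definition supp (X : Type) (Phi : set (X -> R)) (h : X -> \bar R) :
    set (X -> R) :=
  [set phi | Phi phi /\ forall x, ((phi x)%:E <= h x)%E].

Definition slt (X : Type) (phi : X -> R) (alpha : R) : set X :=
  [set x | phi x < alpha].

Definition intersection_property (X : Type) (phi1 phi2 : X -> R) (alpha : R) :=
  forall t : R, 0 <= t <= 1 ->
    let phit := fun x => t * phi1 x + (1 - t) * phi2 x in
    slt phit alpha `&` slt phi1 alpha = set0 \/
    slt phit alpha `&` slt phi2 alpha = set0.

Definition lagrangian (X Y : Type) (f : X -> \bar R)
    (g : Y -> \bar R) (L : X -> Y) (x : X) (psi : Y -> R) : \bar R :=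
  (f x + (psi (L x))%:E - conjugate g psi)%dE.

Definition closed_add_const (X : Type) (Phi : set (X -> R)) :=
  forall phi (c : R), Phi phi -> Phi (fun x => phi x + c).

End AbstractConvexity.

(* Main.v *)
(* Write [g''] for the [Psi]-biconjugate of [g].  As
   [inf (f + g'' o L) = inf (f + g o L)], the first equality in (ii) holds
   unconditionally, because [sup_psi L(x, psi) = f x + g''(L x)]: only the
   minimax equality is at stake.  From (ii) to (i), take a [psi] with
   [alpha < inf L(., psi)] and the constant [alpha] twice.  Conversely, the
   intersection property yields one convex combination of [phi1] and [phi2]
   that is everywhere at least [alpha], and [L(x, .)] is concave. *)
Require Import Defs.
From mathcomp Require Import ring lra.

Set Implicit Arguments.
Unset Strict Implicit.
Unset Printing Implicit Defensive.

Import Order.TTheory GRing.Theory Num.Theory.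
Import DualAddTheory.

Local Open Scope classical_set_scope.
Local Open Scope ring_scope.

(** Connectedness of [0, 1] gives this: if every combination dipped below [alpha], each would do so
    inside exactly one of the sublevel sets of [phi1] and [phi2], splitting the interval into two
    nonempty open pieces. *)
Lemma intersection_property_combination (R : realType) (X : Type)
    (phi1 phi2 : X -> R) (alpha : R) :
  intersection_property phi1 phi2 alpha ->
  exists2 t : R, 0 <= t <= 1 &
    forall x, alpha <= t * phi1 x + (1 - t) * phi2 x.
Proof.
move=> ip.
have disj t x y : 0 <= t <= 1 ->
    t * phi1 x + (1 - t) * phi2 x < alpha -> phi1 x < alpha ->
    t * phi1 y + (1 - t) * phi2 y < alpha -> phi2 y < alpha -> False.
  move=> t01 tx x1 ty y2; have [E|E] := ip t t01.
    by have : set0 x by rewrite -E.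
  by have : set0 y by rewrite -E.
have [A1|nA1] := pselect (forall x, alpha <= phi1 x).
  by exists 1; [lra|move=> x; have := A1 x; lra].
have [x1 x1P] : exists x, phi1 x < alpha.
  by move/existsNP : nA1 => [x /negP]; rewrite -ltNge; exists x.
have [A2|nA2] := pselect (forall x, alpha <= phi2 x).
  by exists 0; [lra|move=> x; have := A2 x; lra].
have [x2 x2P] : exists x, phi2 x < alpha.
  by move/existsNP : nA2 => [x /negP]; rewrite -ltNge; exists x.
(* At [t = 1] the combination is [phi1], so a common point would make its sublevel set meet both. *)
have sep x : phi1 x < alpha -> phi2 x < alpha -> False.
  have h := disj 1 x1 x; move=> h1 h2; apply: h => //; lra.
(* The [t] whose strict sublevel set meets [phi2 < alpha] and those meeting
   [phi1 < alpha] form disjoint relatively open subsets of [0, 1], so [sup T]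
   belongs to neither. *)
pose T := [set t : R | 0 <= t <= 1 /\
  exists2 y, phi2 y < alpha & t * phi1 y + (1 - t) * phi2 y < alpha].
have T0 : T 0 by split; [lra|exists x2 => //; lra].
have hT : has_sup T.
  by split; [exists 0|exists 1 => t [/andP[]]].
have s0 : 0 <= sup T by exact: sup_upper_bound.
have s1 : sup T <= 1.
  by apply: ge_sup; [exists 0|move=> t [/andP[]]].
exists (sup T); first by rewrite s0.
set s := sup T in s0 s1 * => x; rewrite leNgt; apply/negP => xs.
have [x2lt|x2ge] := ltP (phi2 x) alpha.
  have x1ge : alpha <= phi1 x by rewrite leNgt; apply/negP => /sep; apply.
  pose d := alpha - (s * phi1 x + (1 - s) * phi2 x).
  (* Raising the parameter from [s] by [e] uses up half of the slack [d] at [x], so [s + e] would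
     still lie in [T], beyond its supremum. *)
  pose e := d / (2 * (phi1 x - phi2 x)).
  have D0 : 0 < phi1 x - phi2 x by lra.
  have d0 : 0 < d by rewrite /d; lra.
  have e0 : 0 < e by rewrite divr_gt0// mulr_gt0.
  have eD : e * (phi1 x - phi2 x) = d / 2.
    by rewrite /e; field; rewrite gt_eqF.
  suff : T (s + e) by move/(sup_upper_bound hT); rewrite -/s; lra.
  (* At parameter 1 the value at [x] is [phi1 x >= alpha], so going from [s] to 1 raises it by at
     least [d]. *)
  have es : e <= 1 - s.
    rewrite -(ler_pM2r D0) eD; rewrite /d in d0 *; nra.
  split; first by lra.
  exists x => //.
  have -> : (s + e) * phi1 x + (1 - (s + e)) * phi2 x =
    s * phi1 x + (1 - s) * phi2 x + e * (phi1 x - phi2 x) by ring.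
  by rewrite eD /d; lra.
have x1lt : phi1 x < alpha.
  by rewrite ltNge; apply/negP => x1ge; nra.
pose d := alpha - (s * phi1 x + (1 - s) * phi2 x).
pose e := d / (2 * (phi2 x - phi1 x)).
have D0 : 0 < phi2 x - phi1 x by lra.
have d0 : 0 < d by rewrite /d; lra.
have e0 : 0 < e by rewrite divr_gt0// mulr_gt0.
have eD : e * (phi2 x - phi1 x) = d / 2.
  by rewrite /e; field; rewrite gt_eqF.
(* A [t] in [T] within [e] of [s] keeps [x] below [alpha]; its sublevel set then meets that of
   [phi1] at [x] and that of [phi2] at [y]. *)
have [t [t01 [y y2 ty]] ste] := sup_adherent e0 hT.
rewrite -/s in ste.
apply: (disj t x y) => //.
have : (s - t) * (phi2 x - phi1 x) <= e * (phi2 x - phi1 x).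
  by rewrite ler_pM2r//; lra.
rewrite eD /d; lra.
Qed.

(** For real [a], translation is an order isomorphism. The identity fails for [a = -oo] with [S] a
    set of reals unbounded above, and for [a = +oo] with [S] empty. *)
Lemma dadde_ereal_sup (R : realType) (a : \bar R) (S : set (\bar R)) :
  a != -oo%E -> S !=set0 ->
  (a + ereal_sup S)%dE = ereal_sup [set ((a + x)%dE : \bar R) | x in S].
Proof.
move=> aNy [s Ss]; apply/eqP; rewrite eq_le; apply/andP; split; last first.
  apply: ge_ereal_sup => _ [x Sx <-].
  by apply: lee_dD2l; exact: ereal_sup_ubound.
case: a aNy => [r _|_|//]; last first.
  by apply: ereal_sup_ubound; exists s => //; rewrite daddye.
rewrite -lee_dsubr_addl//; apply: ge_ereal_sup => x Sx.
by rewrite lee_dsubr_addl//; apply: ereal_sup_ubound; exists x.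
Qed.

Lemma ereal_sup_lagrangian (R : realType) (X Y : Type) (f : X -> \bar R)
    (g : Y -> \bar R) (L : X -> Y) (Psi : set (Y -> R)) (x : X) :
  f x != -oo%E -> Psi !=set0 ->
  ereal_sup [set lagrangian f g L x psi | psi in Psi] =
  (f x + biconjugate Psi g (L x))%dE.
Proof.
move=> fx Psi0; rewrite /biconjugate dadde_ereal_sup//; last first.
  by case: Psi0 => psi Psipsi; eexists; exists psi.
rewrite image_comp; congr ereal_sup; apply: eq_imagel => psi _ /=.
by rewrite /lagrangian daddeA.
Qed.

(** Weak duality, valid for any coupling [h]. *)
Lemma ereal_sup_inf_le (R : realType) (X I : Type) (A : set X) (B : set I)
    (h : X -> I -> \bar R) :
  (ereal_sup [set ereal_inf [set h x i | x in A] | i in B] <=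
   ereal_inf [set ereal_sup [set h x i | i in B] | x in A])%E.
Proof.
apply: ge_ereal_sup => _ [i Bi <-]; apply: le_ereal_inf_tmp => _ [x Ax <-].
apply: (@le_trans _ _ (h x i)).
  by apply: ereal_inf_lbound; exists x.
by apply: ereal_sup_ubound; exists i.
Qed.

(** Reals are dense in the extended line; this reduces the minimax inequality to the real levels
    [alpha] of (i). *)
Lemma lee_of_lt_real (R : realType) (a b : \bar R) :
  (forall r : R, (r%:E < a)%E -> (r%:E <= b)%E) -> (a <= b)%E.
Proof.
move=> ab; rewrite leNgt; apply/negP => ba.
have [r br ra] : exists2 r : R, (b < r%:E)%E & (r%:E < a)%E.
  case: a b ba {ab} => [a||] [b||] //= ba.
  - by exists ((a + b) / 2); move: ba; rewrite !lte_fin => ba; lra.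
  - by exists (a - 1); rewrite ?ltNyr// lte_fin; lra.
  - by exists (b + 1); rewrite ?ltry// lte_fin; lra.
  - by exists 0; rewrite ?ltNyr ?ltry.
by have := ab r ra; rewrite leNgt br.
Qed.

(** The conjugate is a supremum of maps affine in [psi]. Taking its two values real avoids products
    with infinities. *)
Lemma conjugate_convex (R : realType) (Y : Type) (g : Y -> \bar R)
    (psi1 psi2 : Y -> R) (c1 c2 t : R) :
  (forall y, (-oo < g y)%E) -> 0 <= t <= 1 ->
  conjugate g psi1 = c1%:E -> conjugate g psi2 = c2%:E ->
  (conjugate g (fun y => (t * psi1 y + (1 - t) * psi2 y)%R) <=
   (t * c1 + (1 - t) * c2)%:E)%E.
Proof.
move=> gNy /andP[t0 t1] e1 e2; apply: ge_ereal_sup => _ [y _ <-].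
have psiy psi c : conjugate g psi = c%:E -> (((psi y)%:E - g y)%dE <= c%:E)%E.
  by move=> <-; apply: ereal_sup_ubound; exists y.
move: (psiy _ _ e1) (psiy _ _ e2); have := gNy y.
case: (g y) => [r _||//]; last by move=> *; rewrite leNye.
rewrite -!dEFinB !lee_fin => h1 h2; nra.
Qed.

(** An affine term minus a convex conjugate. Real lower bounds [a1], [a2] in place of values allow
    [f x = +oo]. *)
Lemma lagrangian_concave (R : realType) (X Y : Type) (f : X -> \bar R)
    (g : Y -> \bar R) (L : X -> Y) (x : X) (psi1 psi2 : Y -> R)
    (a1 a2 t : R) :
  (-oo < f x)%E -> (forall y, (-oo < g y)%E) -> 0 <= t <= 1 ->
  conjugate g psi1 \is a fin_num -> conjugate g psi2 \is a fin_num ->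
  (a1%:E <= lagrangian f g L x psi1)%E ->
  (a2%:E <= lagrangian f g L x psi2)%E ->
  ((t * a1 + (1 - t) * a2)%:E <=
   lagrangian f g L x (fun y => (t * psi1 y + (1 - t) * psi2 y)%R))%E.
Proof.
move=> fx gNy t01 /fineK/esym e1 /fineK/esym e2.
have := conjugate_convex gNy t01 e1 e2.
rewrite /lagrangian e1 e2.
case: (f x) fx => [r _||//]; last by move=> *; rewrite !daddye leey.
case: (conjugate _ _) => [c||] //.
  rewrite -!dEFinD !lee_fin; move: t01 => /andP[t0 t1] *; nra.
by move=> *; rewrite leey.
Qed.

(** A finite [g y] keeps the conjugate above [-oo]; were it [+oo], the Lagrangian at a point where
    [f x < +oo] would be [-oo]. *)
Lemma conjugate_fin_num (R : realType) (X Y : Type) (f : X -> \bar R)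
    (g : Y -> \bar R) (L : X -> Y) (x : X) (y : Y) (psi : Y -> R) :
  (-oo < g y)%E -> (g y < +oo)%E -> (f x < +oo)%E ->
  (-oo < lagrangian f g L x psi)%E -> conjugate g psi \is a fin_num.
Proof.
move=> gNy gy fy; have : (((psi y)%:E - g y)%dE <= conjugate g psi)%E.
  by apply: ereal_sup_ubound; exists y.
rewrite /lagrangian; case: (g y) gNy gy => // r _ _.
by case: (conjugate g psi) => //; case: (f x) fy.
Qed.

Theorem proposition6p6 (R : realType) (X : Type) (Y : lmodType R)
  (X_neq0 : [set: X] !=set0)
  (f : X -> \bar R) (g : Y -> \bar R) (L : X -> Y)
  (f_gtNy : forall x, (-oo < f x)%E) (g_gtNy : forall y, (-oo < g y)%E)
  (domgf : edom g `&` (L @` edom f) !=set0)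
  (Phi : set (X -> R)) (Psi : set (Y -> R))
  (Phi_add : closed_add_const Phi) (Psi_add : closed_add_const Psi)
  (Phi0 : Phi (cst 0)) (Psi0 : Psi (cst 0))
  (Psi_convex : @convex_set R (Y -> R^o) Psi)
  (inf_biconj :
    ereal_inf [set ((f x + biconjugate Psi g (L x))%dE : \bar R) | x in [set: X]]
    = ereal_inf [set ((f x + g (L x))%dE : \bar R) | x in [set: X]])
  (inf_lty :
    (ereal_inf [set ((f x + g (L x))%dE : \bar R) | x in [set: X]] < +oo)%E) :
  (forall alpha : R,
     (alpha%:E < ereal_inf [set ereal_sup [set lagrangian f g L x psi | psi in Psi]
                           | x in [set: X]])%E ->
     exists psi1 psi2 : Y -> R, Psi psi1 /\ Psi psi2 /\
       exists phi1 phi2 : X -> R,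
         supp Phi (fun x => lagrangian f g L x psi1) phi1 /\
         supp Phi (fun x => lagrangian f g L x psi2) phi2 /\
         intersection_property phi1 phi2 alpha)
  <->
  [/\ ereal_inf [set ((f x + g (L x))%dE : \bar R) | x in [set: X]]
      = ereal_inf [set ereal_sup [set lagrangian f g L x psi | psi in Psi]
                  | x in [set: X]],
      ereal_inf [set ereal_sup [set lagrangian f g L x psi | psi in Psi]
                | x in [set: X]]
      = ereal_sup [set ereal_inf [set lagrangian f g L x psi | x in [set: X]]
                  | psi in Psi]
    & (ereal_sup [set ereal_inf [set lagrangian f g L x psi | x in [set: X]]
                 | psi in Psi] < +oo)%E].
Proof.
have fNy x : f x != -oo%E by rewrite gt_eqF.
have Psi_ne : Psi !=set0 by exists (cst 0).
have infsupE :
    ereal_inf [set ereal_sup [set lagrangian f g L x psi | psi in Psi]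
              | x in [set: X]] =
    ereal_inf [set ((f x + g (L x))%dE : \bar R) | x in [set: X]].
  rewrite -inf_biconj; congr ereal_inf; apply: eq_imagel => x _.
  exact: ereal_sup_lagrangian.
have weak := ereal_sup_inf_le [set: X] Psi (lagrangian f g L).
split=> [H|[_ minimax _] alpha]; last first.
  rewrite minimax => /ereal_sup_gt[_ [psi Psipsi <-] alt].
  exists psi, psi; split=> //; split=> //.
  have suppa : supp Phi (lagrangian f g L ^~ psi) (cst alpha).
    split=> [|x].
      have := Phi_add _ alpha Phi0.
      by congr Phi; apply/funext => x; rewrite /= add0r.
    apply: (le_trans (ltW alt)); apply: ereal_inf_lbound.
    by exists x.
  exists (cst alpha), (cst alpha); split=> //; split=> // t _ /=; left.
  by apply/seteqP; split=> // x [_]; rewrite /slt /= ltxx.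
split=> //; last by apply: (le_lt_trans weak); rewrite infsupE.
apply/eqP; rewrite eq_le weak andbT; apply: lee_of_lt_real => alpha.
move=> /H [psi1 [psi2 [P1 [P2 [phi1 [phi2 [[_ s1] [[_ s2] ip]]]]]]]].
have [t t01 ht] := intersection_property_combination ip.
have [y0 [gy [x0 fx0 _]]] := domgf.
(* A real-valued minorant forces the Lagrangian above [-oo] at [x0], a point of the domain of
   [f]. *)
have fin psi phi : (forall x, (phi x)%:E <= lagrangian f g L x psi)%E ->
    conjugate g psi \is a fin_num.
  move=> /(_ x0) h; apply: (conjugate_fin_num (g_gtNy _) gy fx0).
  exact: lt_le_trans (ltNyr _) h.
have /andP[t0 t1] := t01.
apply: le_ereal_sup_tmp; eexists.
  (* The weight [t] found for [phi1], [phi2] is reused for [psi1], [psi2]. *)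
  exists (fun y => t * psi1 y + (1 - t) * psi2 y); last by [].
  have := Psi_convex psi1 psi2 (Itv01 t0 t1); rewrite !inE.
  exact.
apply: le_ereal_inf_tmp => _ [x _ <-].
apply: (@le_trans _ _ (t * phi1 x + (1 - t) * phi2 x)%:E).
  by rewrite lee_fin.
by apply: lagrangian_concave => //; [exact: (fin _ phi1)|exact: (fin _ phi2)].
Qed.
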